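(* Let $X$ be a compact metrizable space and let $A$ be a compact subset of $X$. Then $A$ is a squeezable subset of $X$ if and only if $A$ is a squashable subset of $X$.
   Context: A decomposition of a topological space $X$ means an upper semi-continuous decomposition: a partition $\mathcal{G}$ of $X$ into compact subsets such that the quotient map $\pi : X \to X/\mathcal{G}$ (with $X/\mathcal{G}$ given the quotient topology) is a closed map. A collection $\mathcal{C}$ of subsets of a metric space $(X,\rho)$ is null if for every $\epsilon > 0$ the set $\{C \in \mathcal{C} : \mathrm{diam}_\rho(C) \geq \epsilon\}$ is finite. A null decomposition is a decomposition that is a null collection. Let $X$ be a compact metrizable space with metric $\rho$ (any metric inducing the topology; the notions below do not depend on the choice). $C(X,X)$ denotes the set of continuous maps $X \to X$ with the supremum metric $\bar{\rho}$ determined by $\rho$. For $C \subset X$, $\mathcal{H}_C(X)$ denotes the set of all homeomorphisms $h : X \to X$ with $h|_C = \mathrm{id}_C$, and $\mathrm{cl}(\mathcal{H}_C(X))$ denotes its closure in $C(X,X)$. A subset $A$ of $X$ is squeezable if $A$ is compact and for every null decomposition $\mathcal{G}$ of $X$ with $A \in \mathcal{G}$, every open neighborhood $U$ of $A$ in $X$, and every $\delta > 0$, there is a homeomorphism $h \in \mathcal{H}_{X-U}(X)$ such that $\mathrm{diam}_\rho(h(A)) < \delta$ and for every $G \in \mathcal{G}$, either $\mathrm{diam}_\rho(h(G)) < \delta$ or $h|_G = \mathrm{id}_G$. A subset $A$ of $X$ is squashable if $A$ is compact and for every null decomposition $\mathcal{G}$ of $X$ with $A \in \mathcal{G}$, every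 open neighborhood $U$ of $A$ in $X$, and every $\delta > 0$, there is a map $f \in \mathrm{cl}(\mathcal{H}_{X-U}(X))$ such that $f(A)$ is a one-point set $\{p\}$, $f$ maps $X - A$ homeomorphically onto $X - \{p\}$, and for every $G \in \mathcal{G}$, either $\mathrm{diam}_\rho(f(G)) < \delta$ or $f|_G = \mathrm{id}_G$. *)

(* Defs.v *)
From HB Require Import structures.
From mathcomp Require Import all_boot all_order all_algebra.
From mathcomp Require Import all_classical all_reals all_analysis.

Set Implicit Arguments.
Unset Strict Implicit.
Unset Printing Implicit Defensive.

Import Order.TTheory GRing.Theory Num.Theory.

Local Open Scope classical_set_scope.
Local Open Scope ring_scope.
Local Open Scope quotient_scope.

Definition closed_map (S T : topologicalType) (f : S -> T) : Prop :=
  forall F : set S, closed F -> closed (f @` F).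

(* f restricts to a homeomorphism from the subspace A onto the subspace B;
   the values of f off A and of g off B are irrelevant. *)
Definition homeo_on (S T : topologicalType) (A : set S) (B : set T)
    (f : S -> T) : Prop :=
  exists g : T -> S,
    [/\ f @` A = B,
        (forall x, A x -> g (f x) = x),
        {within A, continuous f}
      & {within B, continuous g}].

Definition homeomorphism (S T : topologicalType) (f : S -> T) : Prop :=
  homeo_on [set: S] [set: T] f.

Section Decomposition.
Context {X : topologicalType}.
Implicit Type G : set (set X).

(* x and y lie in exactly the same members of G.  This is an equivalence
   relation for any G; when G is a partition, it says that x and y lie in the
   same block. *)
Definition same_block G (x y : X) : bool :=
  `[< forall C, G C -> (C x <-> C y) >].

Lemma same_block_refl G : reflexive (same_block G).
Proof. by move=> x; apply/asboolP. Qed.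

Lemma same_block_sym G : symmetric (same_block G).
Proof.
move=> x y; apply/asboolP/asboolP => H C GC; exact: iff_sym (H C GC).
Qed.

Lemma same_block_trans G : transitive (same_block G).
Proof.
move=> y x z /asboolP xy /asboolP yz; apply/asboolP => C GC.
exact: iff_trans (xy C GC) (yz C GC).
Qed.

Canonical same_block_equiv G : equiv_rel X :=
  EquivRel (same_block G) (@same_block_refl G) (@same_block_sym G)
    (@same_block_trans G).

Definition decomposition_space G : topologicalType :=
  quotient_topology {eq_quot (same_block_equiv G)}.

Definition decomposition_map G : X -> decomposition_space G :=
  \pi_{eq_quot (same_block_equiv G)}.

Definition decomposition G : Prop :=
  [/\ partition G id [set: X],
      (forall C, G C -> compact C)
    & closed_map (@decomposition_map G)].

End Decomposition.

Section Metric.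
Context {R : realType} {X : metricType R}.

(* Extended-real valued; diam set0 = -oo, which plays no role below since the
   blocks of a partition are nonempty. *)
Definition diam (A : set X) : \bar R :=
  ereal_sup [set (mdist p.1 p.2)%:E | p in A `*` A].

Definition null_collection (C : set (set X)) : Prop :=
  forall e : R, 0 < e -> finite_set [set A | C A /\ (e%:E <= diam A)%E].

Definition null_decomposition (G : set (set X)) : Prop :=
  decomposition G /\ null_collection G.

(* The continuous maps X -> X with the topology of the supremum metric: the
   ball of radius e around f consists of the g such that
   mdist (f x) (g x) < e for all x. *)
Definition cmaps : pseudoMetricType R :=
  initial_topology
    (fun f : continuousType X X => (f : X -> X) : arrow_uniform_type X X).

Definition homeos_fixing (C : set X) : set cmaps :=
  [set h : continuousType X X |
    homeomorphism h /\ forall x, C x -> h x = x].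

Definition squeezable (A : set X) : Prop :=
  compact A /\
  forall G : set (set X), null_decomposition G -> G A ->
  forall U : set X, open U -> A `<=` U ->
  forall delta : R, 0 < delta ->
  exists h : continuousType X X,
    [/\ homeos_fixing (~` U) h,
        (diam (h @` A) < delta%:E)%E
      & forall C, G C ->
          (diam (h @` C) < delta%:E)%E \/ (forall x, C x -> h x = x)].

Definition squashable (A : set X) : Prop :=
  compact A /\
  forall G : set (set X), null_decomposition G -> G A ->
  forall U : set X, open U -> A `<=` U ->
  forall delta : R, 0 < delta ->
  exists (f : continuousType X X) (p : X),
    [/\ closure (homeos_fixing (~` U)) f,
        f @` A = [set p],
        homeo_on (~` A) (~` [set p]) f
      & forall C, G C ->
          (diam (f @` C) < delta%:E)%E \/ (forall x, C x -> f x = x)].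

End Metric.

(* Main.v *)
Require Import Defs.
From mathcomp Require Import all_boot all_order all_algebra.
From mathcomp Require Import all_classical all_reals all_analysis.
From mathcomp Require Import lra.

(** On a compact space, a homeomorphism and a map squashing [A] are two cases
of one notion: a continuous surjection that identifies the points of [A] with
one another and no others ([collapses A], with [A] empty for homeomorphisms).  By
compactness it is a quotient map, so two such maps with the same [A] differ by
a homeomorphism of the target ([collapses_factor]).

Both implications rest on the same control of the blocks of a null
decomposition [G].  Let [h] treat every block well: its image is small or it is
fixed pointwise.  Apart from [A], only finitely many blocks are large, so a
neighbourhood [V] of [A] can avoid all of them; it can also be chosen with
[h(V)] small, as soon as [h(A)] is small.  If [k] agrees with [h] off [V] and
sends [V] into [h(V)], then [k] still treats every block well: a large block is
left to [h], and a block meeting [V] has a small image under [h], enlarged at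
most by the small set [h(V)] ([blocks_controlled]).

Squashable implies squeezable.  Squash [A] by [f], choose [V] for [f], and
squash [A] once more, inside [V], by [f'].  The homeomorphism [phi] such that
[phi \o f' = f] agrees with [f] off [V] and maps [V] into [f(V)]; it is the
required squeeze.

Squeezable implies squashable.  Squeeze [A] by [h], choose [V] for [h], and
replace [h] by [h \o g_1 \o g_2 \o ...], where [g_n] squeezes [A] inside a
neighbourhood [V_n], these neighbourhoods shrinking to [A], and [g_n] squeezes
so strongly that the diameter of [(h \o g_1 \o ... \o g_n)(A)] tends to 0.
The limit squashes [A] ([collapses_limit], [exists_collapse]). *)

Set Implicit Arguments.
Unset Strict Implicit.
Unset Printing Implicit Defensive.

Import Order.TTheory GRing.Theory Num.Theory.

Local Open Scope classical_set_scope.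
Local Open Scope ring_scope.

(** * Maps collapsing one compact set *)

Section Collapses.
Context {S T : topologicalType}.
Hypotheses (compactS : compact [set: S]) (hausdorffT : hausdorff_space T).
Implicit Types (A : set S) (f : S -> T).

(** Compactness turns this condition on the fibres into: [f] induces a
homeomorphism from [S / A] to [T].  For [A = set0], it says that [f] is a
continuous bijection, that is, a homeomorphism. *)
Definition collapses A f : Prop :=
  [/\ continuous f, (forall y, exists x, f x = y)
    & forall x y, f x = f y <-> x = y \/ A x /\ A y].

Lemma compact_closed_map f : continuous f -> closed_map f.
Proof.
move=> fc F cF; apply: compact_closed => //.
apply: continuous_compact; first exact: continuous_subspaceT.
exact: subclosed_compact compactS _.
Qed.

(** Continuity descends along [f] because [f] is closed: the points off the
interior of the preimage of a neighbourhood of [phi y] have a closed image, and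
[y] is not in it.  Only continuity along the fibre of [y] is assumed, so that
the lemma also applies to the inverse of a map that is injective only off
[A]. *)
Lemma closed_map_descent (U : topologicalType) f (phi : T -> U) (y : T) :
  continuous f -> (forall z, exists x, f x = z) ->
  (forall x, f x = y -> phi (f x') @[x' --> x] --> phi y) ->
  {for y, continuous phi}.
Proof.
move=> fc fs H W Wy.
pose N := (phi \o f) @^-1` W.
have cl : closed (f @` (~` N°)).
  apply: compact_closed_map => //; apply: open_closedC; exact: open_interior.
have : nbhs y (~` (f @` (~` N°))).
  apply: open_nbhs_nbhs; split; first exact: closed_openC.
  by move=> [x + fxy]; apply; exact: (H x fxy W Wy).
rewrite /nbhs/=; apply: filterS => z nz /=.
have [x xz] := fs z.
have [/interior_subset|Nx] := pselect (N° x); first by rewrite /N/= xz.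
by exfalso; apply: nz; exists x.
Qed.

(** For [A = set0] this produces a homeomorphism, and for nonempty [A] the
homeomorphism between complements required of a squashing map. *)
Lemma collapses_homeo_on A f : closed A -> collapses A f ->
  homeo_on (~` A) (~` (f @` A)) f.
Proof.
move=> cA [fc fs fE].
have [g fg] := choice fs.
have gf x : ~ A x -> g (f x) = x.
  by move=> Ax; have /fE[//|[_ /Ax]] := fg (f x).
exists g; split => //.
- apply/seteqP; split => [_ [x Ax <-] [a Aa /fE[ax|[_ /Ax//]]]|y yA].
    by apply: Ax; rewrite -ax.
  have [x xy] := fs y; exists x => // Ax; apply: yA; exists x => //.
- exact: continuous_subspaceT.
rewrite continuous_open_subspace; last exact/closed_openC/compact_closed_map.
move=> y; rewrite inE => yA.
apply: (closed_map_descent fc fs) => x xy.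
have Ax : ~ A x by move=> Ax; apply: yA; exists x.
rewrite -xy gf//.
apply: cvg_trans; last exact: cvg_id.
apply: near_eq_cvg.
have : nbhs x (~` A) by apply: open_nbhs_nbhs; split => //; exact: closed_openC.
by rewrite /nbhs/=; apply: filterS => z /gf ->.
Qed.

Lemma homeo_on_collapses A f : continuous f ->
  (forall x y, A x -> A y -> f x = f y) ->
  homeo_on (~` A) (~` (f @` A)) f -> collapses A f.
Proof.
move=> fc fA [g [fE gf _ _]]; split => //.
  move=> y; have [[x _ xy]|] := pselect ((f @` A) y); first by exists x.
  by rewrite -[X in X -> _]/((~` _) y) -fE => -[x _ xy]; exists x.
have out x y : ~ A x -> A y -> f x <> f y.
  move=> Ax Ay xy.
  have : (f @` ~` A) (f x) by exists x.
  by rewrite fE; apply; exists y.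
move=> x y; split => [xy|[->//|[Ax Ay]]]; last exact: fA.
have [Ax|Ax] := pselect (A x); have [Ay|Ay] := pselect (A y).
- by right.
- by exfalso; exact: out Ay Ax _.
- by exfalso; exact: out Ax Ay _.
- by left; rewrite -(gf x)// -(gf y)// xy.
Qed.

Lemma homeomorphismP f : continuous f ->
  homeomorphism f <-> collapses set0 f.
Proof.
move=> fc; rewrite /homeomorphism.
have e1 : ~` (set0 : set S) = setT by rewrite setC0.
have e2 : ~` (f @` set0) = setT by rewrite image_set0 setC0.
split=> [h|]; first by apply: homeo_on_collapses => //; rewrite e1 e2.
by move=> /(collapses_homeo_on closed0); rewrite e1 e2.
Qed.

End Collapses.

Lemma collapses_comp (S T U : topologicalType) (A : set S)
    (f : S -> T) (h : T -> U) :
  collapses A f -> collapses set0 h -> collapses A (h \o f).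
Proof.
move=> [fc fs fE] [hc hs hE]; split.
- by move=> x; apply: continuous_comp; [exact: fc|exact: hc].
- by move=> z; have [y <-] := hs z; have [x <-] := fs y; exists x.
- move=> x y /=; rewrite -fE; split => [/hE[//|[]//]|-> //].
Qed.

(** [f] and [f'] have the same fibres, so [phi] is well defined and injective;
it is continuous because [f'] is a quotient map. *)
Lemma collapses_factor (S T : topologicalType) (A : set S) (f f' : S -> T) :
  compact [set: S] -> hausdorff_space T ->
  collapses A f -> collapses A f' ->
  exists2 phi : T -> T, collapses set0 phi & forall x, phi (f' x) = f x.
Proof.
move=> cS hT [fc fs fE] [f'c f's f'E].
have [g f'g] := choice f's.
have phiE x : f (g (f' x)) = f x by apply/fE/f'E; rewrite f'g.
exists (f \o g) => //; split.
- move=> y; apply: (closed_map_descent cS hT f'c f's) => x <- /=.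
  rewrite phiE (_ : (fun _ => _) = f); first exact: fc.
  by apply/funext => z; rewrite phiE.
- by move=> y; have [x <-] := fs y; exists (f' x); rewrite /= phiE.
- move=> y z; split=> [/= /fE/f'E|[->//|[]//]].
  by rewrite !f'g; left.
Qed.

(** * Diameters and small neighbourhoods *)

Section Diam.
Context {R : realType} {X : metricType R}.
Implicit Types (A B : set X) (e : R).

Lemma diam_leP B e : (diam B <= e%:E)%E <->
  forall x y, B x -> B y -> mdist x y <= e.
Proof.
split=> [/ereal_supP H x y Bx By|H].
  by rewrite -lee_fin; apply: H; exists (x, y).
by apply/ereal_supP => _ [[x y] [/= Bx By] <-]; rewrite lee_fin H.
Qed.

Lemma diam_lt_exists B e : 0 < e -> (diam B < e%:E)%E ->
  exists2 e', 0 <= e' < e & (diam B <= e'%:E)%E.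
Proof.
move=> e0 Be; case E : (diam B) Be => [r| |] //=.
  rewrite lte_fin => re; exists (Num.max 0 r); last first.
    by rewrite lee_fin le_max lexx orbT.
  by rewrite le_max lexx /= gt_max e0.
by move=> _; exists 0; rewrite ?lexx ?leNye.
Qed.

Lemma diamS A B : A `<=` B -> (diam A <= diam B)%E.
Proof.
move=> AB; apply: ereal_sup_le => _ [[x y] [/= Ax Ay] <-].
by exists (x, y) => //; split; exact: AB.
Qed.

Lemma diam_closure B e : (diam B <= e%:E)%E -> (diam (closure B) <= e%:E)%E.
Proof.
move=> /diam_leP H; apply/diam_leP => x y Bx By.
apply/ler_addgt0Pl => d d0.
have d2 : 0 < d / 2 by rewrite divr_gt0.
have [x' [Bx']] := Bx _ (nbhsx_ballx x _ d2).
have [y' [By']] := By _ (nbhsx_ballx y _ d2).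
rewrite !ballEmdist/= => yy xx.
have := H _ _ Bx' By'.
have := metric_triangle x x' y.
have := metric_triangle x' y' y.
rewrite (metric_sym y' y); lra.
Qed.

(** Taking interiors of balls makes the union open by construction. *)
Definition thickening A e : set X := \bigcup_(a in A) (ball a e)°.

Lemma open_thickening A e : open (thickening A e).
Proof. by apply: bigcup_open => a _; exact: open_interior. Qed.

Lemma sub_thickening A e : 0 < e -> A `<=` thickening A e.
Proof. by move=> e0 a Aa; exists a => //; exact: nbhsx_ballx. Qed.

Lemma thickening_dist A e x : thickening A e x ->
  exists2 a, A a & mdist a x < e.
Proof.
by move=> [a Aa /interior_subset]; rewrite ballEmdist/= => ?; exists a.
Qed.

Lemma exists_nbhs_small_image A U (h : X -> X) e :
  continuous h -> open U -> A `<=` U -> 0 < e -> (diam (h @` A) < e%:E)%E ->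
  exists V, [/\ open V, A `<=` V, V `<=` U & (diam (h @` V) <= e%:E)%E].
Proof.
move=> hc oU AU e0 /(diam_lt_exists e0)[e' /andP[e'0 e'e] /diam_leP He'].
pose r := (e - e') / 2; have r0 : 0 < r by rewrite divr_gt0// subr_gt0.
exists (U `&` h @^-1` (thickening (h @` A) r)); split.
- apply: openI => //; move/continuousP: hc; apply; exact: open_thickening.
- move=> a Aa; split; first exact: AU.
  by apply: sub_thickening => //; exists a.
- by move=> x [].
- apply/diam_leP => u v [x [_ /thickening_dist[a Aa ax]] <-{u}].
  move=> [y [_ /thickening_dist[b Ab yb]] <-{v}].
  have := He' _ _ Aa Ab.
  have := metric_triangle (h x) a (h y); have := metric_triangle a b (h y).
  rewrite (metric_sym (h x) a) /r in ax yb *; lra.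
Qed.

Lemma compact_uniformly_continuous (f : X -> X) : compact [set: X] ->
  continuous f -> forall e, 0 < e ->
  exists2 d, 0 < d & forall x y, mdist x y < d -> mdist (f x) (f y) < e.
Proof.
move=> /compact_near_coveringP cX fc e e0.
have e2 : 0 < e / 2 by rewrite divr_gt0.
pose P (d : R) x := forall y, mdist x y < d -> mdist (f x) (f y) < e.
suff /(filterI (nbhs_right_gt (0 : R)))/filter_ex[d [/= d0 H]] :
    \forall d \near (0 : R)^'+, [set: X] `<=` P d.
  by exists d => // x; exact: H.
apply: (cX _ _ P) => x _.
have /nbhs_ballP[r /= r0 H] := fc x _ (nbhsx_ballx (f x) _ e2).
exists (ball x (r / 2), [set d : R | d < r / 2]) => /=.
  by split; [apply: nbhsx_ballx|apply: nbhs_right_lt]; rewrite divr_gt0.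
move=> [x' d] /= [xx' dr] y x'y.
have xy : ball x r y.
  rewrite [r](splitr r); apply: ball_triangle xx' _.
  by rewrite ballEmdist/=; apply: lt_trans x'y dr.
have := H _ xy; have := H x'; rewrite !ballEmdist/= in xx' *.
have r2 : r / 2 < r by lra.
move=> /(_ (lt_trans xx' r2)) h1 h2.
have := metric_triangle (f x') (f x) (f y).
rewrite (metric_sym (f x') (f x)); lra.
Qed.

End Diam.

(** * Limits of homeomorphisms with shrinking supports *)

Section Limit.
Context {R : realType} {X : metricType R}.
Hypothesis compactX : compact [set: X].
Variables (A : set X) (f : nat -> X -> X) (V : nat -> set X).
Hypotheses (fhomeo : forall n, collapses set0 (f n))
  (AV : forall n, A `<=` V n)
  (VS : forall n, V n.+1 `<=` V n)
  (f_out : forall n x, ~ V n x -> f n.+1 x = f n x)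
  (f_in : forall n x, V n x -> (f n @` V n) (f n.+1 x))
  (f_small : forall e, 0 < e -> exists n, (diam (f n @` V n) <= e%:E)%E)
  (V_shrinks : forall x, ~ A x -> exists n, ~ closure (V n) x).

Let hausdorffX : hausdorff_space X := @metric_hausdorff _ X.

(** From stage [n] on, every modification takes place inside [V n] and keeps the
images of the points of [V n] in [f n @` V n]; the limit needs no more. *)
Lemma nested_supports n k :
  [/\ V (n + k)%N `<=` V n, (forall x, ~ V n x -> f (n + k)%N x = f n x)
    & (forall x, V n x -> (f n @` V n) (f (n + k)%N x))].
Proof.
elim: k => [|k [sV out inn]]; first by rewrite addn0; split=> // x Vx; exists x.
rewrite addnS; split => [x /VS/sV//|x nx|x Vx].
  by rewrite f_out ?out// => /sV.
have [Vkx|Vkx] := pselect (V (n + k)%N x); last by rewrite f_out//; exact: inn.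
have [y Vy <-] := f_in Vkx; exact: inn (sV _ Vy).
Qed.

(** Compactness supplies a cluster point of each sequence [f n x].  No Cauchy
estimate is needed: a cluster point lies in the closure of every set that
contains a tail of the sequence. *)
Lemma exists_limit : exists F : X -> X, forall n,
  (forall x, ~ V n x -> F x = f n x) /\
  (forall x, V n x -> closure (f n @` V n) (F x)).
Proof.
have /choice[F FE] x : exists y, cluster (f n x @[n --> \oo]) y.
  have [y [_ cy]] := compactX (F := f n x @[n --> \oo]) _ filterT.
  by exists y.
have tail x n (B : set X) : (forall k, B (f (n + k)%N x)) -> closure B (F x).
  move=> H C /(FE x B C); apply.
  exists n => // m /= nm; rewrite -(subnKC nm); exact: H.
exists F => n; have nest := nested_supports n.
split=> x Vx; last by apply: tail => k; have [_ _ ] := nest k; apply.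
have : closure [set f n x] (F x).
  by apply: tail => k; have [_ out _] := nest k; exact: out.
rewrite -(closure_id _).1// => //.
exact/accessible_closed_set1/hausdorff_accessible.
Qed.

(** Off [A] the limit agrees locally with some homeomorphism [f n], while on [A]
it is constant since [f n @` V n] shrinks to a point. *)
Lemma collapses_limit : exists F : X -> X,
  [/\ collapses A F, (forall x, ~ V 0%N x -> F x = f 0%N x)
   & forall e, 0 < e -> exists n, forall x, mdist (F x) (f n x) <= e].
Proof.
have [F FE] := exists_limit.
have out n : forall x, ~ V n x -> F x = f n x := (FE n).1.
have inn n : forall x, V n x -> closure (f n @` V n) (F x) := (FE n).2.
have near_f e : 0 < e -> exists n, forall x, mdist (F x) (f n x) <= e.
  move=> e0; have [n /diam_closure/diam_leP dn] := f_small e0; exists n => x.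
  have [Vx|Vx] := pselect (V n x); last by rewrite (out n)// mdistxx ltW.
  apply: dn; first exact: inn.
  by apply: subset_closure; exists x.
exists F; split => //; last exact: (out 0%N).
have Fc : continuous F.
  move=> x; apply/metricType_numDomainType.cvgrPdist_lt => e e0.
  have e3 : 0 < e / 4 by rewrite divr_gt0.
  have [n Fn] := near_f _ e3.
  have [fc _ _] := fhomeo n.
  move/metricType_numDomainType.cvgrPdist_lt : (fc x) => /(_ _ e3).
  rewrite /nbhs/=; apply: filterS => y /= xy.
  have := metric_triangle (F x) (f n x) (F y).
  have := metric_triangle (f n x) (f n y) (F y).
  have := Fn x; have := Fn y; rewrite (metric_sym (F y) (f n y)); lra.
(* A point [x] off the closure of [V n] is sent by [f n] off the closed set
   [f n @` closure (V n)], which contains [F y] for every [y] in [V n]. *)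
have sep x y : ~ A x -> F x = F y -> x = y.
  move=> /V_shrinks[n nx] Fxy.
  have [fc _ fE] := fhomeo n.
  have Vx : ~ V n x by move=> /subset_closure.
  have [Vy|Vy] := pselect (V n y); last first.
    by move: Fxy; rewrite !(out n)// => /fE[//|[]//].
  exfalso; apply: nx.
  have cl : closed (f n @` closure (V n)).
    apply: compact_closed_map => //; exact: closed_closure.
  have : (f n @` closure (V n)) (F x).
    apply: cl; rewrite Fxy.
    apply: closure_subset (inn _ _ Vy); apply: image_subset.
    exact: subset_closure.
  by rewrite (out n)// => -[z Vz /fE[<-//|[]//]].
split => // [y|x y].
  have : closed (range F) by apply: compact_closed_map => //; exact: closedT.
  move=> cl; have [x _ xy] : range F y; last by exists x.
  apply: cl => B /nbhs_ballP[e /= e0 yB].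
  have e2 : 0 < e / 2 by rewrite divr_gt0.
  have [n Fn] := near_f _ e2.
  have [_ /(_ y)[x xy] _] := fhomeo n.
  exists (F x); split; first by exists x.
  apply: yB; rewrite ballEmdist/= metric_sym -xy (le_lt_trans (Fn x))//.
  by rewrite ltr_pdivrMr// ltr_pMr// ltr1n.
split => [Fxy|[->//|[Ax Ay]]].
  have [Ax|/sep/(_ Fxy)] := pselect (A x); last by left.
  have [Ay|/sep/(_ (esym Fxy))] := pselect (A y); last by left.
  by right.
apply: mdist_positivity; apply/eqP; rewrite eq_le mdist_ge0 andbT.
apply/ler_addgt0Pl => e e0; rewrite addr0.
have [n /diam_closure/diam_leP dn] := f_small e0.
by apply: dn; apply: inn; exact: AV.
Qed.

End Limit.

(** * Squashing as an infinite composition of squeezes *)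

Section Squashing.
Context {R : realType} {X : metricType R}.
Hypothesis compactX : compact [set: X].
Let hausdorffX : hausdorff_space X := @metric_hausdorff _ X.

(** The recursion is [f n.+1 = f n \o g], starting from [h], with [g] supported
in [V n].  Composing on the right lets every step squeeze the same set [A], so
the hypothesis need not be transported to the images of [A]; uniform continuity
of [f n] says how far [g] has to squeeze. *)
Lemma exists_collapse (A V : set X) (h : X -> X) :
  compact A ->
  (forall U, open U -> A `<=` U -> forall e : R, 0 < e ->
    exists g : X -> X, [/\ collapses set0 g, (forall x, ~ U x -> g x = x)
      & (diam (g @` A) < e%:E)%E]) ->
  collapses set0 h -> open V -> A `<=` V ->
  exists F : X -> X,
  [/\ collapses A F, (forall x, ~ V x -> F x = h x)
   & forall e : R, 0 < e -> exists k : X -> X,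
      [/\ collapses set0 k, (forall x, ~ V x -> k x = h x)
        & forall x, mdist (F x) (k x) < e]].
Proof.
move=> cA squeeze hh oV AV.
pose good (s : (X -> X) * set X) :=
  [/\ collapses set0 s.1, open s.2 & A `<=` s.2].
pose next (r : R) (s t : {s | good s}) :=
  [/\ (sval t).2 `<=` (sval s).2,
      (forall x, ~ (sval s).2 x -> (sval t).1 x = (sval s).1 x),
      (forall x, (sval s).2 x -> ((sval s).1 @` (sval s).2) ((sval t).1 x)),
      (diam ((sval t).1 @` (sval t).2) <= r%:E)%E
    & (sval t).2 `<=` thickening A r].
have step n (s : {s | good s}) : exists t, next n.+1%:R^-1 s t.
  case: s => -[f U] [/= fh oU AU].
  pose r : R := n.+1%:R^-1; have r0 : 0 < r by rewrite invr_gt0.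
  have r2 : 0 < r / 2 by rewrite divr_gt0.
  have [fc _ _] := fh.
  have [d d0 fd] := compact_uniformly_continuous compactX fc r2.
  have [g [gh gU gA]] := squeeze U oU AU _ d0.
  have fgh : collapses set0 (f \o g) by exact: collapses_comp.
  have [fgc _ _] := fgh.
  have small : (diam ((f \o g) @` A) < r%:E)%E.
    apply: (@le_lt_trans _ _ (r / 2)%:E); last by rewrite lte_fin; lra.
    apply/diam_leP => _ _ [x Ax <-] [y Ay <-]; apply/ltW/fd.
    have [d' /andP[_ d'd] /diam_leP H] := diam_lt_exists d0 gA.
    by apply: le_lt_trans d'd; apply: H; [exists x|exists y].
  have oU' : open (U `&` thickening A r).
    by apply: openI => //; exact: open_thickening.
  have AU' : A `<=` U `&` thickening A r.
    by move=> a Aa; split; [exact: AU|exact: sub_thickening].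
  have [W [oW AW WU Wr]] := exists_nbhs_small_image fgc oU' AU' r0 small.
  have gW : good (f \o g, W) by [].
  exists (exist _ _ gW); split => //=.
  - by move=> x /WU[].
  - by move=> x /gU ->.
  (* [g] preserves [U]: it is injective and fixes the complement of [U]. *)
  - move=> x Ux; exists (g x) => //; apply: contrapT => /[dup] ngx /gU.
    by have [_ _ gE] := gh; move=> /gE[gxx|[]//]; apply: ngx; rewrite gxx.
  - by move=> x /WU[].
have [nxt nxtP] := choice (fun ns => step ns.1 ns.2).
have good0 : good (h, V) by [].
pose s := fix s n : {s | good s} :=
  if n is m.+1 then nxt (m, s m) else exist _ _ good0.
have sP n : next n.+1%:R^-1 (s n) (s n.+1) by exact: (nxtP (n, s n)).
pose f n := (sval (s n)).1; pose W n := (sval (s n)).2.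
have goods n : good (f n, W n) by rewrite /f /W; case: (s n) => -[].
have fh n : collapses set0 (f n) by have [] := goods n.
have AW n : A `<=` W n by have [] := goods n.
have WS n : W n.+1 `<=` W n by have [] := sP n.
have f_out n x : ~ W n x -> f n.+1 x = f n x by have [_ + _ _ _] := sP n; apply.
have f_in n x : W n x -> (f n @` W n) (f n.+1 x).
  by have [_ _ + _ _] := sP n; apply.
have f_small e : 0 < e -> exists n, (diam (f n @` W n) <= e%:E)%E.
  move=> /ltr_add_invr[n]; rewrite add0r => /ltW ne; exists n.+1.
  by have [_ _ _ + _] := sP n => /le_trans; apply; rewrite lee_fin.
have W_shrinks x : ~ A x -> exists n, ~ closure (W n) x.
  move=> Ax.
  have : nbhs x (~` A).
    apply: open_nbhs_nbhs; split => //; apply: closed_openC.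
    exact: compact_closed.
  move=> /nbhs_ballP[e /= e0 xA].
  have e2 : 0 < e / 2 by rewrite divr_gt0.
  have [n] := ltr_add_invr e2; rewrite add0r => ne; exists n.+1.
  move=> /(_ _ (nbhsx_ballx x _ e2))[y [Wy]]; rewrite ballEmdist/= => xy.
  have [_ _ _ _ /(_ _ Wy)/thickening_dist[a Aa ay]] := sP n.
  have := xA a; rewrite ballEmdist/=; apply => //.
  have := lt_trans ay ne; have := metric_triangle x y a.
  rewrite (metric_sym y a); lra.
have [F [FA Fout Fnear]] :=
  collapses_limit compactX fh AW WS f_out f_in f_small W_shrinks.
exists F; split => // e e0.
have e2 : 0 < e / 2 by rewrite divr_gt0.
have [n Fn] := Fnear _ e2.
exists (f n); split => // [x Vx|x].
  by have [_ out _] := nested_supports WS f_out f_in 0 n; exact: out.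
by rewrite (le_lt_trans (Fn x))// ltr_pdivrMr// ltr_pMr// ltr1n.
Qed.

End Squashing.

(** * Control of the blocks of a null decomposition *)

Section Blocks.
Context {R : realType} {X : metricType R}.
Implicit Types (A U V : set X) (G : set (set X)).

(** Reduces the topology of [cmaps] to uniform approximation. *)
Lemma closure_homeos_fixingP U (f : continuousType X X) :
  closure (homeos_fixing U) f <-> forall e : R, 0 < e ->
  exists k : continuousType X X,
    homeos_fixing U k /\ forall x, mdist (f x) (k x) < e.
Proof.
have ballE e (k : continuousType X X) : 
    ball (f : @cmaps R X) e (k : @cmaps R X) <-> forall x, mdist (f x) (k x) < e.
  rewrite -initial_ballE; split=> H x; have := H x; by rewrite ballEmdist.
split=> [fU e e0|H B /nbhs_ballP[e /= e0 fB]].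
  have [k [Uk /ballE]] := fU _ (nbhsx_ballx (f : @cmaps R X) _ e0).
  by exists k.
have [k [Uk /ballE fk]] := H e e0.
by exists k; split => //; exact: fB.
Qed.

Lemma closure_homeos_fixing_id U (f : continuousType X X) x :
  closure (homeos_fixing U) f -> U x -> f x = x.
Proof.
move=> /closure_homeos_fixingP fU Ux.
apply: mdist_positivity; apply/eqP; rewrite eq_le mdist_ge0 andbT.
apply/ler_addgt0Pl => e e0; rewrite addr0.
by have [k [[_ /(_ x Ux) kx] /(_ x)]] := fU e e0; rewrite kx => /ltW.
Qed.

(** The union of the large blocks other than [A] is a finite union of compact
sets disjoint from [A]. *)
Lemma exists_nbhs_avoiding_big_blocks G A U (e : R) :
  null_decomposition G -> G A -> open U -> A `<=` U -> 0 < e ->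
  exists W, [/\ open W, A `<=` W, W `<=` U &
    forall C, G C -> C <> A -> (e%:E <= diam C)%E -> forall x, C x -> ~ W x].
Proof.
move=> [[[_ tG _] cG _] nG] GA oU AU e0.
pose big := [set C | [/\ G C, C <> A & (e%:E <= diam C)%E]].
pose K := \bigcup_(C in big) C.
have cK : closed K.
  apply: closed_bigcup => [|C [GC _ _]].
    by apply: sub_finite_set (nG e e0) => C [].
  by apply: compact_closed; [exact: metric_hausdorff|exact: cG].
exists (U `&` ~` K); split.
- by apply: openI => //; exact: closed_openC.
- move=> a Aa; split; [exact: AU|move=> [C [GC CA _] Ca]].
  by apply/CA/tG => //; exists a.
- by move=> x [].
- by move=> C GC CA Ce x Cx [_]; apply; exists C.
Qed.

(** A block meeting [V] is either [A], whose image lies in [h @` V], or small,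
so that in both cases its image under [h] has diameter at most [e / 2].  Its
image under [k] lies in the union of [h @` C] and [h @` V], which share a point:
the total is at most [e / 2 + e / 4]. *)
Lemma blocks_controlled G A V (h k : X -> X) (e : R) :
  0 < e -> A `<=` V ->
  (forall C, G C -> C <> A -> ((e / 2)%:E <= diam C)%E ->
    forall x, C x -> ~ V x) ->
  (forall C, G C ->
    (diam (h @` C) < (e / 2)%:E)%E \/ forall x, C x -> h x = x) ->
  (diam (h @` V) <= (e / 4)%:E)%E ->
  (forall x, ~ V x -> k x = h x) ->
  (forall x, V x -> (h @` V) (k x)) ->
  forall C, G C -> (diam (k @` C) < e%:E)%E \/ forall x, C x -> k x = x.
Proof.
move=> e0 AV big hG hV k_out k_in C GC.
have e2 : 0 < e / 2 by rewrite divr_gt0.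
have [[z [Cz Vz]]|CV] := pselect (exists z, C z /\ V z); last first.
  have kh x : C x -> k x = h x.
    by move=> Cx; apply: k_out => Vx; apply: CV; exists x.
  have -> : k @` C = h @` C by apply: eq_imagel => x Cx; exact: kh.
  have [hC|hC] := hG C GC; last by right=> x Cx; rewrite kh// hC.
  by left; apply: lt_le_trans hC _; rewrite lee_fin; lra.
left; apply: (@le_lt_trans _ _ (3 * e / 4)%:E); last by rewrite lte_fin; lra.
have /diam_leP hC : (diam (h @` C) <= (e / 2)%:E)%E.
  have [CA|CA] := pselect (C = A).
    have hAV : h @` A `<=` h @` V by apply: image_subset.
    by rewrite CA (le_trans (diamS hAV))// (le_trans hV)// lee_fin; lra.
  have [/ltW//|hid] := hG C GC.
  have -> : h @` C = C.
    by rewrite -[RHS]image_id; apply: eq_imagel => x; exact: hid.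
  by rewrite leNgt; apply/negP => /ltW /(big _ GC CA)/(_ z Cz).
move/diam_leP: hV => hV.
have kC x : C x -> (h @` C) (k x) \/ (h @` V) (k x).
  move=> Cx; have [/k_in|/k_out ->] := pselect (V x); first by right.
  by left; exists x.
have hCz : (h @` C) (h z) by exists z.
have hVz : (h @` V) (h z) by exists z.
apply/diam_leP => _ _ [x /kC kx <-] [y /kC ky <-].
have := metric_triangle (k x) (h z) (k y).
case: kx => kx; case: ky => ky.
- by have := hC _ _ kx ky; lra.
- by have := hC _ _ kx hCz; have := hV _ _ hVz ky; lra.
- by have := hV _ _ kx hVz; have := hC _ _ hCz ky; lra.
- by have := hV _ _ kx ky; lra.
Qed.

End Blocks.

(** * Equivalence of the two notions *)

Section Main.
Context {R : realType} {X : metricType R}.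
Hypothesis compactX : compact [set: X].
Let hausdorffX : hausdorff_space X := @metric_hausdorff _ X.

(** The first squeeze [h] takes care of all blocks at once; the further ones are
confined to [V] and only have to contract [A], because [blocks_controlled] needs
no information on what happens inside [h @` V]. *)
Lemma squeezable_squashable (A : set X) : squeezable A -> squashable A.
Proof.
move=> [cA sq]; split => // G nG GA U oU AU e e0.
have e2 : 0 < e / 2 by rewrite divr_gt0.
have e4 : 0 < e / 4 by rewrite divr_gt0.
have [a Aa] : A !=set0 by have [[[_ _ +] _ _] _] := nG; apply.
have [W [oW AW WU big]] := exists_nbhs_avoiding_big_blocks nG GA oU AU e2.
have [h [[hh hU] hA hG]] := sq G nG GA U oU AU _ e4.
have hc : continuous h by exact: cts_fun.
have {}hh := (homeomorphismP compactX hausdorffX hc).1 hh.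
have [V [oV AV VW hV]] := exists_nbhs_small_image hc oW AW e4 hA.
have squeeze U' : open U' -> A `<=` U' -> forall d : R, 0 < d ->
    exists g : X -> X, [/\ collapses set0 g, (forall x, ~ U' x -> g x = x)
      & (diam (g @` A) < d%:E)%E].
  move=> oU' AU' d d0; have [g [[gh gU] gA _]] := sq G nG GA U' oU' AU' d d0.
  exists g; split => //.
  by apply/(homeomorphismP compactX) => //; exact: cts_fun.
have [F [FA FV Fnear]] := exists_collapse compactX cA squeeze hh oV AV.
have [Fc Fs FE] := FA.
have [_ hs hE] := hh.
(* [F] and [h] agree off [V], so a value [h z] with [z] off [V] is attained by
   [F] at [z], hence not at a point of [V]. *)
have F_in x : V x -> (h @` V) (F x).
  move=> Vx; have [z hz] := hs (F x); exists z => //.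
  apply: contrapT => Vz; apply: (Vz); move: hz; rewrite -(FV z)//.
  by move=> /FE[->|[/AV]].
have FAE : F @` A = [set F a].
  apply/seteqP; split => [_ [x Ax <-]|_ ->]; last by exists a.
  by apply/FE; right.
exists (mkcts Fc), (F a); split => //.
- apply/closure_homeos_fixingP => d d0.
  have [k [kh kV kF]] := Fnear d d0; have [kc _ _] := kh.
  exists (mkcts kc); split => //; split; first exact/(homeomorphismP compactX).
  by move=> x Ux; rewrite [LHS]kV ?hU// => /VW/WU.
- rewrite -FAE; apply: (collapses_homeo_on compactX) => //.
  exact: compact_closed.
- apply: (blocks_controlled e0 AV _ _ hV FV F_in).
    by move=> C GC CA Ce x Cx /VW; exact: big Cx.
  move=> C GC; have [hC|] := hG C GC; [left|by right].
  by apply: lt_trans hC _; rewrite lte_fin; lra.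
Qed.

(** A homeomorphism close to [f] need not fix the large blocks that [f] fixes,
so approximating [f] is not enough.  Undoing [f] inside [V] by a second
squashing [f'] gives a homeomorphism that equals [f] exactly off [V]. *)
Lemma squashable_squeezable (A : set X) : squashable A -> squeezable A.
Proof.
move=> [cA sq]; split => // G nG GA U oU AU e e0.
have e2 : 0 < e / 2 by rewrite divr_gt0.
have e4 : 0 < e / 4 by rewrite divr_gt0.
have collapse (f : continuousType X X) p : f @` A = [set p] ->
    homeo_on (~` A) (~` [set p]) f -> collapses A f.
  move=> fA; rewrite -fA; apply: homeo_on_collapses; first exact: cts_fun.
  have fp x : A x -> f x = p.
    by move=> Ax; have : (f @` A) (f x) by [exists x]; rewrite fA.
  by move=> x y Ax Ay; rewrite !fp.
have [W [oW AW WU big]] := exists_nbhs_avoiding_big_blocks nG GA oU AU e2.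
have [f [p [fU fA fh fG]]] := sq G nG GA U oU AU _ e2.
have fcol := collapse f p fA fh.
have fAe : (diam (f @` A) < (e / 4)%:E)%E.
  rewrite fA; apply: (@le_lt_trans _ _ 0%:E); last by rewrite lte_fin.
  by apply/diam_leP => x y -> ->; rewrite mdistxx.
have [V [oV AV VW fV]] := exists_nbhs_small_image (@cts_fun _ _ f) oW AW e4 fAe.
have [f' [p' [f'V f'A f'h _]]] := sq G nG GA V oV AV _ e4.
have f'col := collapse f' p' f'A f'h.
have [phi phih phiE] := collapses_factor compactX hausdorffX fcol f'col.
have [phic _ _] := phih.
have f'_out x : ~ V x -> f' x = x.
  by move=> Vx; exact: closure_homeos_fixing_id f'V Vx.
have phi_out x : ~ V x -> phi x = f x by move=> Vx; rewrite -phiE f'_out.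
have phi_in x : V x -> (f @` V) (phi x).
  move=> Vx; have [_ /(_ x)[z zx] _] := f'col.
  exists z; last by rewrite -phiE zx.
  by apply: contrapT => Vz; apply: (Vz); rewrite -(f'_out z)// zx.
exists (mkcts phic); split.
- split; first exact/(homeomorphismP compactX).
  move=> x Ux; rewrite [LHS]phi_out; last by move=> /VW/WU.
  exact: closure_homeos_fixing_id fU Ux.
- apply: (@le_lt_trans _ _ (e / 4)%:E); last by rewrite lte_fin; lra.
  apply: le_trans fV; apply: diamS => _ [x Ax <-]; exact/phi_in/AV.
- apply: (blocks_controlled e0 AV _ fG fV phi_out phi_in).
  by move=> C GC CA Ce x Cx /VW; exact: big Cx.
Qed.

End Main.

Theorem theorem3 (R : realType) (X : metricType R) (A : set X)
    (compactX : compact [set: X]) (compactA : compact A) :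
  squeezable A <-> squashable A.
Proof.
split; [exact: squeezable_squashable|exact: squashable_squeezable].
Qed.
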